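(* Let $\alpha\ge 1$ be fixed. Suppose that $\lambda_1<\lambda_2<\ldots<\lambda_R$, and that $\lambda_{r+1}-\lambda_r\ge\delta>0$ for $1\le r<R$. Then for any ${\bf w}$, $$\left|\sum_{r\ne s}\frac{(\lambda_r\lambda_s)^{\frac{\alpha-1}{2}}\,w_r\overline{w_s}}{\lambda_r^{\alpha}-\lambda_s^{\alpha}}\right|\le\frac{\pi}{\alpha\delta}\sum_{r}|w_r|^2 .$$
   Context: Here $\lambda_1,\dots,\lambda_R$ are real numbers, ${\bf w}=(w_1,\dots,w_R)$ is a sequence of complex numbers, and the sums run over indices $r,s$ (respectively $r$) in $\{1,\dots,R\}$.
   Formalization: For α > 1 all λ_r are assumed nonnegative (α = 1 allows any reals): otherwise the powers may be undefined, and the inequality fails, e.g. α = 5, λ = (−1/2, 1/2), δ = 1, w = (1, i); all λ_r ≤ 0 with integer α follows by λ → −λ. *)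

(* Defs.v *)
From HB Require Import structures.
From mathcomp Require Import all_boot all_order all_algebra.
From mathcomp Require Import complex.
From mathcomp Require Import reals exp trigo.
Set Implicit Arguments.
Unset Strict Implicit.
Unset Printing Implicit Defensive.
Import Order.TTheory GRing.Theory Num.Theory.
Local Open Scope ring_scope.

(* Real powers x^a. The library's powR is the usual real power only for x >= 0
   (with 0^0 = 1); integer exponents make sense for every base, so they use the
   ring power. In particular x^0 = 1 and x^1 = x also for x < 0. The value is
   not meaningful when x < 0 and a is not an integer. *)
Definition rpow (R : realType) (x a : R) : R :=
  if a \is a Num.int then x ^ Num.floor a else x `^ a.

(* Main.v *)
Require Import Defs.
From HB Require Import structures.
From mathcomp Require Import all_boot all_order all_algebra.
From mathcomp Require Import spectral complex ring lra.
From mathcomp Require Import classical_sets reals topology.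
From mathcomp Require Import normedtype sequences derive realfun exp trigo.
Import Order.TTheory GRing.Theory Num.Theory.
Import numFieldNormedType.Exports.
Local Open Scope classical_set_scope.
Local Open Scope ring_scope.

(** Put [mu_r = lambda_r ^ alpha] and [c_r = lambda_r ^ ((alpha - 1) / 2)].  The
sum is the Hermitian form of the real skew-symmetric matrix
[a_rs = c_r c_s / (mu_r - mu_s)] with zero diagonal, a weighted Hilbert matrix.
Such a matrix is normal, so the spectral theorem reduces the inequality to a
bound on its eigenvalues ([quadratic_form_spectral_bound]).

For an eigenvector [v] with eigenvalue [d], the squared norm of [v A] is
[|d|^2 sum_r |v_r|^2]; it is also the form of [v] on the Gram matrix with
entries [sum_s a_rs a_ts].  The partial fraction
[1/((x-z)(y-z)) = (1/(x-y)) (1/(y-z) - 1/(x-z))] splits the off-diagonal Gram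
entries into a part [a_rt (F_t - F_r)] and a part supported on the pair [r, t].
The eigenvector equation turns the first part into
[d sum_t F_t |v_t|^2 - d sum_t F_t |v_t|^2 = 0].  What is left is controlled by
the row sums of [c_r c_s (c_r c_s + c_r^2 + c_s^2) / (mu_r - mu_s)^2]
([eigenvalue_bound]).  This is the argument of Montgomery and Vaughan, with
weights.

Each of these kernel entries is at most
[3 / (alpha^2 (lambda_r - lambda_s)^2)], with equality for [alpha = 1]
([rpow_kernel_le]).  Writing [lambda_r / lambda_s = exp (2 u)] and
[alpha = 1 + p], this says
[(1+p)^2 sinh^2 u (1 + 2 cosh (p u)) <= 3 sinh^2 ((1+p) u)]
([sinh_ratio]), which follows from [sinh x <= x cosh x] and from the inequality
[s^2 (1 + 2 cosh s) <= 3 sinh^2 s] in one variable.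

Since [|lambda_r - lambda_s| >= delta |r - s|], each row sum is at most
[(3 / (alpha delta)^2) * 2 zeta(2) = (pi / (alpha delta))^2].  The bound
[zeta(2) <= pi^2/6] on partial sums comes from iterating
[1/sin^2 x = (1/4) (1/sin^2 (x/2) + 1/sin^2 ((x+pi)/2))]
([sum_inv_sq_le]). *)

(** * Hyperbolic functions *)
Lemma ge0_from_derivative (R : realType) (f f' : R -> R) :
  (forall x : R, is_derive x 1 f (f' x)) -> 0 <= f 0 ->
  (forall x, 0 <= x -> 0 <= f' x) -> forall x, 0 <= x -> 0 <= f x.
Proof.
move=> df f0 f'0 x x0.
have cf : {within `[0, x]%classic, continuous f}.
  apply: continuous_subspaceT => y.
  by apply/differentiable_continuous/derivable1_diffP; have [] := df y.
have [c /itvP cI fE] := MVT_segment x0 (fun y _ => df y) cf.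
have -> : f x = f 0 + f' c * x by lra.
by rewrite addr_ge0// mulr_ge0// f'0// cI.
Qed.

Definition sinh {R : realType} (x : R) : R := (expR x - expR (- x)) / 2.
Definition cosh {R : realType} (x : R) : R := (expR x + expR (- x)) / 2.

Section Hyperbolic.
Context {R : realType}.
Implicit Types x u p : R.
Notation sinh := (@sinh R).
Notation cosh := (@cosh R).

#[local] Instance is_derive_sinh x : is_derive x 1 sinh (cosh x).
Proof.
rewrite /sinh /cosh.
by apply: trigger_derive; rewrite /GRing.scale /=; ring.
Qed.

#[local] Instance is_derive_cosh x : is_derive x 1 cosh (sinh x).
Proof.
rewrite /sinh /cosh.
by apply: trigger_derive; rewrite /GRing.scale /=; ring.
Qed.

Lemma sinh0 : sinh 0 = 0.
Proof. by rewrite /sinh oppr0 subrr mul0r. Qed.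

Lemma cosh0 : cosh 0 = 1.
Proof. by rewrite /cosh oppr0 expR0; lra. Qed.

Lemma cosh2E x : cosh x ^+ 2 = sinh x ^+ 2 + 1.
Proof. by have := expRxMexpNx_1 x; rewrite /sinh /cosh => h; nra. Qed.

Lemma sinhD x y : sinh (x + y) = sinh x * cosh y + cosh x * sinh y.
Proof. by rewrite /sinh /cosh opprD !expRD; field. Qed.

Lemma cosh_gt0 x : 0 < cosh x.
Proof. by rewrite divr_gt0// addr_gt0// expR_gt0. Qed.

Lemma cosh_ge1 x : 1 <= cosh x.
Proof. by have := cosh_gt0 x; have := cosh2E x; have := sqr_ge0 (sinh x); nra. Qed.

Lemma le_sinh x : 0 <= x -> x <= sinh x.
Proof.
move=> x0; rewrite -subr_ge0.
apply: (@ge0_from_derivative _ (fun y => sinh y - y) (fun y => cosh y - 1)) => //.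
- by rewrite sinh0 subrr.
- by move=> y _; rewrite subr_ge0 cosh_ge1.
Qed.

Lemma sinh_ge0 x : 0 <= x -> 0 <= sinh x.
Proof. by move=> x0; rewrite (le_trans x0)// le_sinh. Qed.

Lemma le_cosh x : 0 <= x -> x ^+ 2 / 2 <= cosh x - 1.
Proof.
move=> x0; rewrite -subr_ge0.
apply: (@ge0_from_derivative _ (fun y => cosh y - 1 - y ^+ 2 / 2)
  (fun y => sinh y - y)) => //.
- by move=> y; apply: trigger_derive; rewrite /GRing.scale /=; field.
- by rewrite cosh0 subrr expr0n/= mul0r subrr.
- by move=> y y0; rewrite subr_ge0 le_sinh.
Qed.

Lemma sinh_le_mul_cosh x : 0 <= x -> sinh x <= x * cosh x.
Proof.
move=> x0; rewrite -subr_ge0.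
apply: (@ge0_from_derivative _ (fun y => y * cosh y - sinh y)
  (fun y => y * sinh y)) => //.
- by move=> y; apply: trigger_derive; rewrite /GRing.scale /=; ring.
- by rewrite sinh0 mul0r subrr.
- by move=> y y0; rewrite mulr_ge0// sinh_ge0.
Qed.

(** Both sides agree to order four at 0, and differ by a function whose second
derivative is nonnegative.  That sign only uses [x <= sinh x] and
[x^2 / 2 <= cosh x - 1]: after these substitutions, everything cancels. *)
Lemma sinh_sq_ge x : 0 <= x -> x ^+ 2 * (1 + 2 * cosh x) <= 3 * sinh x ^+ 2.
Proof.
move=> x0; rewrite -subr_ge0.
pose H' y := 6 * sinh y * cosh y - 2 * y - 4 * y * cosh y - 2 * y ^+ 2 * sinh y.
pose H'' y := 6 * (cosh y ^+ 2 + sinh y ^+ 2) - 2 - 4 * cosh y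
  - 8 * y * sinh y - 2 * y ^+ 2 * cosh y.
apply: (@ge0_from_derivative _
  (fun y => 3 * sinh y ^+ 2 - y ^+ 2 * (1 + 2 * cosh y)) H') => //.
- by move=> y; apply: trigger_derive; rewrite /GRing.scale /= /H'; ring.
- by rewrite sinh0 expr0n/= !mul0r mulr0 subrr.
apply: (@ge0_from_derivative _ H' H'') => //.
- by move=> y; apply: trigger_derive; rewrite /GRing.scale /= /H''; ring.
- by rewrite /H' sinh0; lra.
move=> y y0; rewrite /H''.
have := cosh2E y; have := le_cosh _ y0; have := le_sinh _ y0.
have := cosh_ge1 y; move: (sinh y) (cosh y) => S C C1 yS yC CE.
have h1 : y * S <= S ^+ 2 by rewrite expr2 ler_wpM2r// (le_trans y0).
have h2 : y ^+ 2 / 2 * C <= (C - 1) * C by rewrite ler_wpM2r// (le_trans ler01).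
by lra.
Qed.

(** By the addition formula the right-hand side is
[p u (sinh u cosh (p u) + cosh u sinh (p u))], and [x cosh x >= sinh x] applies
at [x = p u] in the first product and at [x = u] in the second. *)
Lemma sinh_mul_ge u p : 0 <= u -> 0 <= p ->
  (1 + p) * sinh u * sinh (p * u) <= p * u * sinh ((1 + p) * u).
Proof.
move=> u0 p0; have pu0 : 0 <= p * u by rewrite mulr_ge0.
rewrite (mulrDl 1 p u) mul1r sinhD.
have h1 := sinh_le_mul_cosh _ u0; have h2 := sinh_le_mul_cosh _ pu0.
have h3 := ler_wpM2l (sinh_ge0 _ u0) h2.
have h4 := ler_wpM2l (mulr_ge0 p0 (sinh_ge0 _ pu0)) h1.
by lra.
Qed.

(** Squaring [sinh_mul_ge] bounds [sinh ((1 + p) u) / ((1 + p) sinh u)] below by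
[sinh s / s] with [s = p u], so only the one-variable inequality [sinh_sq_ge]
at [s] remains. *)
Lemma sinh_ratio u p : 0 <= u -> 0 <= p ->
  (1 + p) ^+ 2 * sinh u ^+ 2 * (1 + 2 * cosh (p * u)) <= 3 * sinh ((1 + p) * u) ^+ 2.
Proof.
move=> u0 p0; have pu0 : 0 <= p * u by rewrite mulr_ge0.
have [z|nz] := eqVneq (p * u) 0.
  rewrite z cosh0; move/eqP: z; rewrite mulf_eq0 => /orP[/eqP->|/eqP->].
    by rewrite addr0 mul1r; lra.
  by rewrite mulr0 sinh0; lra.
have pos : 0 < (p * u) ^+ 2 by rewrite exprn_even_gt0.
rewrite -(ler_pM2l pos).
have h := sinh_mul_ge _ _ u0 p0.
have h2 : ((1 + p) * sinh u * sinh (p * u)) ^+ 2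
    <= (p * u * sinh ((1 + p) * u)) ^+ 2.
  have p1 : 0 <= 1 + p by rewrite addr_ge0.
  have s1 : 0 <= sinh u by exact: sinh_ge0.
  have s2 : 0 <= sinh (p * u) by exact: sinh_ge0.
  have s3 : 0 <= sinh ((1 + p) * u) by rewrite sinh_ge0// mulr_ge0.
  have s4 := mulr_ge0 (mulr_ge0 p1 s1) s2; have s5 := mulr_ge0 pu0 s3.
  by apply: lerXn2r; rewrite // nnegrE.
have h3 := ler_wpM2l (sqr_ge0 ((1 + p) * sinh u)) (sinh_sq_ge _ pu0).
by rewrite !exprMn in h2 h3 *; lra.
Qed.
End Hyperbolic.
(** * Partial sums of zeta(2) *)

Section Basel.
Context {R : realType}.
Implicit Types x : R.
Local Notation pi := (@pi R).

Lemma norm_sin_le x : `|sin x| <= `|x|.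
Proof.
wlog x0 : x / 0 <= x => [hw|].
  have [/hw//|/ltW x0] := leP 0 x.
  by rewrite -(normrN x) -(normrN (sin x)) -sinN hw// oppr_ge0.
have cs : {within `[0, x]%classic, continuous (@sin R)}.
  by apply: continuous_subspaceT; exact: continuous_sin.
have [c /itvP cI] := MVT_segment x0 (fun y _ => is_derive_sin y) cs.
by rewrite sin0 !subr0 => ->; rewrite normrM ler_piMl// cos_max.
Qed.

(** Each doubling splits a node [x] into [x / 2] and [(x + pi) / 2] through
[1/sin^2 x = (1/4) (1/sin^2 (x/2) + 1/cos^2 (x/2))]; after [n] steps the nodes
are [(x + k pi) / 2^n], and [|sin y| <= |y|] is applied there. *)
Lemma sum_inv_sq_le n x : sin x != 0 ->
  \sum_(0 <= k < 2 ^ n) ((x + k%:R * pi) ^+ 2)^-1 <= (sin x ^+ 2)^-1.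
Proof.
elim: n x => [|n IHn] x nz.
  rewrite expn0 big_nat1 mul0r addr0 lef_pV2 ?posrE ?exprn_even_gt0//=.
    by rewrite -(real_normK (num_real x)) -(real_normK (num_real (sin x))) lerXn2r ?nnegrE// norm_sin_le.
  by apply: contraNneq nz => ->; rewrite sin0.
have xpE : (x + pi) / 2 = x / 2 + pi / 2 by rewrite mulrDl.
have sinE : sin x = (cos (x / 2) * sin (x / 2)) *+ 2.
  by rewrite -sin_mulr2n mulr2n -splitr.
have sn : sin (x / 2) != 0.
  by apply: contraNneq nz; rewrite sinE => ->; rewrite mulr0 mul0rn.
have cn : sin ((x + pi) / 2) != 0.
  by apply: contraNneq nz; rewrite xpE sinDpihalf sinE => ->; rewrite mul0r mul0rn.
have -> : (sin x ^+ 2)^-1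
    = ((sin (x / 2) ^+ 2)^-1 + (sin ((x + pi) / 2) ^+ 2)^-1) / 4.
  move: cn; rewrite xpE sinDpihalf sinE => cn.
  have := cos2Dsin2 (x / 2); move: (sin _) (cos _) sn cn => s c sn cn sc.
  rewrite -[LHS]mul1r -{1}sc; field; by rewrite sn cn.
have := lerD (IHn _ sn) (IHn _ cn).
rewrite -(@ler_pM2r _ 4^-1) ?invr_gt0//; apply: le_trans.
have splitE (F : nat -> R) m :
    \sum_(0 <= k < m.*2) F k = \sum_(0 <= k < m) (F k.*2 + F k.*2.+1).
  elim: m => [|m IHm]; first by rewrite !big_geq.
  by rewrite doubleS !big_nat_recr//= IHm addrA.
rewrite -big_split/= expnS mul2n splitE mulr_suml.
rewrite le_eqVlt; apply/orP; left; apply/eqP; apply: eq_bigr => k _.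
have E4 : 4^-1 = (2 ^+ 2)^-1 :> R by rewrite -natrX.
rewrite mulrDl E4 -!invfM -!exprMn; congr ((_ ^+ 2)^-1 + (_ ^+ 2)^-1).
  by rewrite -muln2 natrM; field.
by rewrite -addn1 -muln2 natrD natrM; field.
Qed.

(** The previous bound is applied at a translate of [pi / 2] for which the nodes
are [m pi / 2] with [m] odd, placed symmetrically around 0, so that every
[m^2] occurs twice; the right-hand side is 1. *)
Lemma sum_inv_odd_sq_le n :
  \sum_(0 <= k < 2 ^ n) ((k.*2.+1)%:R ^+ 2)^-1 <= pi ^+ 2 / 8.
Proof.
pose x := pi / 2 - (2 ^ n)%:R * pi.
have sx : sin x ^+ 2 = 1.
  rewrite /x; elim: (2 ^ n)%N => [|m IHm].
    by rewrite mul0r subr0 sin_pihalf expr1n.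
  rewrite -(natr1 m) (mulrDl m%:R) mul1r opprD addrA -[RHS]IHm.
  set y := _ - m%:R * pi.
  by rewrite -[in RHS](subrK pi y) sinDpi sqrrN.
have nz : sin x != 0 by rewrite -sqrf_eq0 sx oner_eq0.
have := sum_inv_sq_le n.+1 _ nz; rewrite sx invr1.
rewrite expnS mul2n -addnn (big_cat_nat _ (n := 2 ^ n)) ?leq_addr//=.
have pi0 := pi_gt0 R.
have p0 : pi != 0 by rewrite gt_eqF.
have shiftE m (F : nat -> R) :
    \sum_(m <= k < m + m) F k = \sum_(0 <= k < m) F (k + m)%N.
  by rewrite -{1}[m]add0n big_addn addnK.
rewrite shiftE big_nat_rev/=.
rewrite -big_split/= => h.
rewrite -(@ler_pM2r _ (8 / pi ^+ 2)) ?divr_gt0 ?exprn_gt0//.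
have cancel8 (p : R) : p != 0 -> p ^+ 2 / 8 * (8 / p ^+ 2) = 1 by move=> ?; field.
rewrite cancel8//; apply: le_trans h; rewrite mulr_suml !big_nat.
rewrite le_eqVlt; apply/orP; left; apply/eqP; apply: eq_bigr => k /andP[_ kn].
have termE (p u N : R) : p != 0 -> u * 2 + 1 != 0 ->
    (u * 2 + 1) ^- 2 * (8 / p ^+ 2)
    = (p / 2 - N * p + (N - (u + 1)) * p) ^- 2 + (p / 2 - N * p + (u + N) * p) ^- 2.
  move=> pN0 uN0.
  rewrite (_ : p / 2 - N * p + (N - (u + 1)) * p = - ((u * 2 + 1) * p / 2)).
    rewrite (_ : p / 2 - N * p + (u + N) * p = (u * 2 + 1) * p / 2).
      by rewrite sqrrN; field; rewrite pN0 uN0.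
    by field.
  by field.
rewrite add0n natrB// natrD /x -[k.*2.+1]addn1 -muln2 natrD natrM -(natr1 k).
by apply: termE => //; rewrite -natrM natr1 pnatr_eq0.
Qed.

(** Separating odd and even terms gives [T (2 m) = odd part + T m / 4] for the
partial sums [T], hence [(3/4) T m <= pi^2 / 8]. *)
Lemma sum_inv_sq_le_zeta2 n :
  \sum_(0 <= k < n) ((k.+1)%:R ^+ 2)^-1 <= pi ^+ 2 / 6.
Proof.
pose T m : R := \sum_(0 <= k < m) ((k.+1)%:R ^+ 2)^-1.
have mono m m' : (m <= m')%N -> T m <= T m'.
  move=> mm'; rewrite /T (big_cat_nat _ mm')//= lerDl.
  by apply: sumr_ge0 => k _; rewrite invr_ge0 sqr_ge0.
have halve m : T m.*2 = \sum_(0 <= k < m) ((k.*2.+1)%:R ^+ 2)^-1 + T m / 4.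
  rewrite /T; elim: m => [|m IHm]; first by rewrite !big_geq// mul0r addr0.
  rewrite doubleS !big_nat_recr//= IHm mulrDl.
  have -> : (m.*2.+2)%:R = (m.+1)%:R * 2 :> R by rewrite -natrM muln2 doubleS.
  have m0 : (m.+1)%:R != 0 :> R by rewrite pnatr_eq0.
  have algE (a b u v : R) : u != 0 ->
      a + b / 4 + v + (u * 2) ^- 2 = a + v + (b / 4 + u ^- 2 / 4).
    by move=> u0; field.
  exact: algE.
have n2 : (n <= 2 ^ n)%N by rewrite ltnW// ltn_expl.
have h1 := halve (2 ^ n)%N; have h2 := sum_inv_odd_sq_le n.
have h3 : T (2 ^ n)%N <= T (2 ^ n).*2 by apply: mono; rewrite -addnn leq_addr.
have h4 := mono _ _ n2; rewrite -/(T n).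
by lra.
Qed.
End Basel.

(** * Skew-symmetric kernels and their eigenvalues *)

Local Open Scope sesquilinear_scope.
Section SpectralBound.
Context {C : numClosedFieldType}.

(** In the coordinates given by a unitary diagonalization, the form is
[sum_i d_i |u_i|^2] with [d_i] the eigenvalues, and the norm is unchanged. *)
Lemma quadratic_form_spectral_bound n (A : 'M[C]_n) (K : C) (w : 'I_n -> C) :
  A \is normalmx ->
  (forall (v : 'rV[C]_n) d, v != 0 -> v *m A = d *: v -> `|d| <= K) ->
  `| \sum_r \sum_s A r s * w r * (w s)^* | <= K * \sum_r `|w r| ^+ 2.
Proof.
move=> /orthomx_spectralP; set P := spectralmx A; set D := spectral_diag A => AE hK.
have Pu : P \is unitarymx := spectral_unitarymx A.
have dK i : `|D 0 i| <= K.
  apply: (hK (row i P)).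
    apply/eqP => Pi0; have /unitarymxP/(congr1 (row i)) := Pu.
    rewrite row_mul Pi0 mul0mx => /rowP/(_ i).
    by rewrite !mxE eqxx => /esym/eqP; rewrite oner_eq0.
  rewrite -row_mul AE !mulmxA mulmxV ?unitarymx_unit// mul1mx.
  by apply/rowP => j; rewrite !mxE (bigD1 i)//= !mxE eqxx mulr1n big1 ?addr0//
    => k ki; rewrite !mxE eq_sym (negbTE ki) mul0r.
pose W : 'rV[C]_n := \row_i w i; pose U := W *m P^t*.
have normE (X : 'rV[C]_n) : (X *m X^t*) 0 0 = \sum_r `|X 0 r| ^+ 2.
  by rewrite mxE; apply: eq_bigr => r _; rewrite !mxE normCK.
have -> : \sum_r `|w r| ^+ 2 = \sum_i `|U 0 i| ^+ 2.
  rewrite -normE /U trmx_mul map_mxM /= trmxCK mulmxA mulmxKtV// normE.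
  by apply: eq_bigr => r _; rewrite mxE.
have -> : \sum_r \sum_s A r s * w r * (w s)^* = \sum_i D 0 i * `|U 0 i| ^+ 2.
  transitivity ((W *m A *m W^t*) 0 0).
    rewrite mxE exchange_big/=; apply: eq_bigr => s _; rewrite !mxE mulr_suml.
    by apply: eq_bigr => r _; rewrite mxE (mulrC (w r)).
  rewrite AE invmx_unitary// !mulmxA -/U -mulmxA.
  have -> : P *m W^t* = U^t* by rewrite /U trmx_mul map_mxM /= trmxCK.
  rewrite mxE; apply: eq_bigr => i _; rewrite mul_mx_diag !mxE.
  by rewrite normCK mulrA (mulrC (D 0 i)).
rewrite mulr_sumr; apply: le_trans (ler_norm_sum _ _ _) _.
by apply: ler_sum => i _; rewrite normrM normrX normr_id ler_wpM2r// exprn_ge0.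
Qed.
End SpectralBound.

Section WeightedHilbert.
Context {C : numClosedFieldType} {n : nat} (c mu : 'I_n -> C).
Hypothesis c_ge0 : forall r, 0 <= c r.
Hypothesis mu_real : forall r, mu r \is Num.real.
Hypothesis mu_inj : injective mu.

(* Division by 0 is 0, so [a], [b] and [e] vanish on the diagonal, and sums may
   run over all indices. *)
Let a r s := c r * c s / (mu r - mu s).
Let b r s := c r * c s * (c r ^+ 2 + c s ^+ 2) / (mu r - mu s) ^+ 2.
Let e r s := c s ^+ 2 / (mu r - mu s).

Let aC r s : (a r s)^* = a r s.
Proof. by apply/CrealP; rewrite !(rpredM, rpredV, rpredB)//; apply: ger0_real. Qed.

Let aN r s : a r s = - a s r.
Proof. by rewrite /a -(opprB (mu s)) invrN mulrN (mulrC (c r)). Qed.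

(** For [s] different from [r] and [t], the term is
[a_rt (e_ts - e_rs)] by partial fractions.  At [s = r] and [s = t] the left-hand
side has a zero term, while the right-hand side has [a_rt e_tr] and
[- a_rt e_rt]; the correction is [b_rt]. *)
Let gram r t : r != t ->
  \sum_s a r s * a t s
  = a r t * (\sum_s e t s - \sum_s e r s) + b r t.
Proof.
move=> rt.
have nz x y : x != y -> mu x - mu y != 0.
  by move=> xy; rewrite subr_eq0 (inj_eq mu_inj).
rewrite -sumrB mulr_sumr.
rewrite (bigD1 r)//= (bigD1 t) 1?eq_sym//= [in RHS](bigD1 r)//= [in RHS](bigD1 t) 1?eq_sym//=.
rewrite /a /b /e !subrr !invr0 !mulr0 ?mul0r ?mulr0 ?add0r ?subr0 ?sub0r.
rewrite (eq_bigr (fun s => c r * c t / (mu r - mu t) *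
    (c s ^+ 2 / (mu t - mu s) - c s ^+ 2 / (mu r - mu s)))).
  have := nz _ _ rt; have : mu t - mu r != 0 by rewrite nz// eq_sym.
  by set S := \sum_(i | _) _ => h1 h2; field; rewrite h1 h2.
move=> s /andP[sr st].
have h1 := nz _ _ rt; have h2 : mu r - mu s != 0 by rewrite nz// eq_sym.
have h3 : mu t - mu s != 0 by rewrite nz// eq_sym.
by field; rewrite h1 h2 h3.
Qed.

Let gram_total r t :
  \sum_s a r s * a t s
  = a r t * (\sum_s e t s - \sum_s e r s) + b r t + (r == t)%:R * \sum_s a r s ^+ 2.
Proof.
have [<-|/gram->] := eqVneq r t; last by rewrite mul0r addr0.
by rewrite subrr mulr0 add0r /b subrr expr0n/= invr0 mulr0 add0r mul1r.
Qed.


(** The eigenvalue is purely imaginary because [a] is real and skew-symmetric.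
Then [d] multiplies both halves of the telescoping part of the Gram form by
the same weighted sum, and they cancel; the rest is a form with nonnegative
symmetric coefficients, bounded by its row sums through
[2 |v_r v_t| <= |v_r|^2 + |v_t|^2]. *)
Lemma eigenvalue_bound (K d : C) (v : 'I_n -> C) :
  0 <= K ->
  (forall r, \sum_s c r * c s * (c r * c s + c r ^+ 2 + c s ^+ 2) / (mu r - mu s) ^+ 2
     <= K ^+ 2) ->
  (exists r, v r != 0) ->
  (forall s, \sum_r v r * a r s = d * v s) -> `|d| <= K.
Proof.
move=> K0 hK [r0 vr0] vE.
pose V := \sum_r `|v r| ^+ 2.
have V0 : 0 < V.
  rewrite /V (bigD1 r0)//= ltr_wpDr ?exprn_gt0 ?normr_gt0//.
  by apply: sumr_ge0 => r _; rewrite exprn_ge0.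
have dV : d * V = \sum_s \sum_r v r * a r s * (v s)^*.
  rewrite mulr_sumr; apply: eq_bigr => s _.
  by rewrite -mulr_suml vE normCK mulrA.
have dN : d^* = - d.
  apply: (mulIf (lt0r_neq0 V0)); rewrite mulNr dV exchange_big/=.
  have -> : d^* * V = (d * V)^*.
    rewrite rmorphM/=; congr (_ * _); apply/esym/CrealP/rpred_sum => r _.
    by rewrite rpredX// ger0_real.
  rewrite dV rmorph_sum -sumrN; apply: eq_bigr => s _.
  rewrite rmorph_sum -sumrN; apply: eq_bigr => r _.
  rewrite rmorphM/= rmorphM/= aC conjCK aN. ring.
have vEC r : \sum_t a r t * (v t)^* = d * (v r)^*.
  rewrite -[d]opprK -dN mulNr -rmorphM/= -vE rmorph_sum -sumrN.
  by apply: eq_bigr => t _; rewrite rmorphM/= aC (aN t) mulrN opprK mulrC.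
pose F t := \sum_s e t s; pose G r := \sum_s a r s ^+ 2.
have normV : `|d| ^+ 2 * V = \sum_r \sum_t v r * (v t)^* * \sum_s a r s * a t s.
  rewrite mulr_sumr.
  transitivity (\sum_s \sum_r \sum_t v r * (v t)^* * (a r s * a t s)).
    apply: eq_bigr => s _.
    rewrite -exprMn -normrM normCK -vE rmorph_sum mulr_suml.
    apply: eq_bigr => r _; rewrite mulr_sumr; apply: eq_bigr => t _.
    by rewrite rmorphM/= aC mulrACA.
  rewrite exchange_big/=; apply: eq_bigr => r _.
  by rewrite exchange_big/=; apply: eq_bigr => t _; rewrite mulr_sumr.
(* Summing first over [r], and over [t] in the second half, both give
   [d * sum_t F t * |v t|^2]. *)
have telescope0 : \sum_r \sum_t v r * (v t)^* * (a r t * (F t - F r)) = 0.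
  transitivity (\sum_r \sum_t (v t)^* * F t * (v r * a r t)
      - \sum_r \sum_t v r * F r * (a r t * (v t)^*)).
    rewrite -sumrB; apply: eq_bigr => r _; rewrite -sumrB.
    by apply: eq_bigr => t _; ring.
  rewrite exchange_big/= -sumrB big1// => t _.
  by rewrite -!mulr_sumr vE vEC; ring.
have b_ge0 r t : 0 <= b r t.
  apply: divr_ge0; last by rewrite real_exprn_even_ge0// rpredB.
  by rewrite !mulr_ge0 ?addr_ge0 ?exprn_ge0.
have bC r t : b r t = b t r.
  by rewrite /b -(opprB (mu t)) sqrrN (mulrC (c r)) (addrC (c r ^+ 2)).
have G_ge0 r : 0 <= G r.
  apply: sumr_ge0 => s _; rewrite real_exprn_even_ge0//.
  by apply/CrealP; exact: aC.
have {}normV : `|d| ^+ 2 * V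
    = \sum_r \sum_t v r * (v t)^* * b r t + \sum_r `|v r| ^+ 2 * G r.
  rewrite normV.
  transitivity (\sum_r (\sum_t v r * (v t)^* * (a r t * (F t - F r))
      + (\sum_t v r * (v t)^* * b r t + `|v r| ^+ 2 * G r))); last first.
    by rewrite !big_split/= telescope0 add0r.
  apply: eq_bigr => r _.
  have -> : `|v r| ^+ 2 * G r = \sum_t v r * (v t)^* * ((r == t)%:R * G r).
    rewrite (bigD1 r)//= eqxx mul1r normCK big1 ?addr0// => t tr.
    by rewrite eq_sym (negbTE tr) mul0r mulr0.
  rewrite -!big_split/=; apply: eq_bigr => t _.
  by rewrite gram_total !mulrDr addrA.
have crossle : `|\sum_r \sum_t v r * (v t)^* * b r t|
    <= \sum_r `|v r| ^+ 2 * \sum_t b r t.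
  apply: (@le_trans _ _ (\sum_r \sum_t (`|v r| ^+ 2 + `|v t| ^+ 2) / 2 * b r t)).
    apply: le_trans (ler_norm_sum _ _ _) _; apply: ler_sum => r _.
    apply: le_trans (ler_norm_sum _ _ _) _; apply: ler_sum => t _.
    rewrite normrM (ger0_norm (b_ge0 _ _)) ler_wpM2r// normrM norm_conjC.
    rewrite ler_pdivlMr// mulr_natr -subr_ge0.
    rewrite (_ : _ - _ = (`|v r| - `|v t|) ^+ 2); last by ring.
    by rewrite real_exprn_even_ge0// rpredB// ger0_real.
  rewrite le_eqVlt; apply/orP; left; apply/eqP.
  transitivity (\sum_r \sum_t `|v r| ^+ 2 / 2 * b r t
      + \sum_r \sum_t `|v t| ^+ 2 / 2 * b r t).
    rewrite -big_split/=; apply: eq_bigr => r _; rewrite -big_split/=.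
    by apply: eq_bigr => t _; rewrite mulrDl mulrDl.
  rewrite [X in _ + X]exchange_big/= -big_split/=; apply: eq_bigr => r _.
  rewrite mulr_sumr -big_split/=; apply: eq_bigr => t _.
  by rewrite (bC t r) -mulrDl -splitr.
have rowle r : \sum_t b r t + G r <= K ^+ 2.
  apply: le_trans (hK r); rewrite le_eqVlt; apply/orP; left; apply/eqP.
  rewrite /G -big_split/=; apply: eq_bigr => s _.
  by rewrite /a /b expr_div_n -mulrDl; congr (_ / _); ring.
have : `|d| ^+ 2 * V <= K ^+ 2 * V.
  rewrite -[leLHS]ger0_norm ?mulr_ge0 ?exprn_ge0 ?(ltW V0)// normV.
  apply: le_trans (ler_normD _ _) _.
  apply: le_trans (lerD crossle (lexx _)) _.
  rewrite ger0_norm; last by apply: sumr_ge0 => r _; rewrite mulr_ge0 ?exprn_ge0.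
  rewrite -big_split/= mulr_sumr; apply: ler_sum => r _.
  by rewrite -mulrDr mulrC ler_wpM2r ?exprn_ge0.
by rewrite ler_pM2r// ler_pXn2r// nnegrE.
Qed.

Lemma weighted_hilbert_inequality (K : C) (w : 'I_n -> C) :
  0 <= K ->
  (forall r, \sum_s c r * c s * (c r * c s + c r ^+ 2 + c s ^+ 2) / (mu r - mu s) ^+ 2
     <= K ^+ 2) ->
  `| \sum_r \sum_s c r * c s / (mu r - mu s) * w r * (w s)^* |
    <= K * \sum_r `|w r| ^+ 2.
Proof.
move=> K0 hK.
pose A : 'M[C]_n := \matrix_(r, s) a r s.
have AC : A^t* = - A by apply/matrixP => r s; rewrite !mxE aC aN.
have -> : \sum_r \sum_s c r * c s / (mu r - mu s) * w r * (w s)^*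
    = \sum_r \sum_s A r s * w r * (w s)^*.
  by apply: eq_bigr => r _; apply: eq_bigr => s _; rewrite mxE.
apply: quadratic_form_spectral_bound.
  by apply/normalmxP; rewrite AC mulmxN mulNmx.
move=> v d vn0 vA; apply: (eigenvalue_bound K d (fun r => v 0 r)) => //.
  by apply/existsP; apply: contraNT vn0 => /existsPn v0; apply/eqP/rowP => j;
    rewrite mxE; apply/eqP; rewrite -[_ == _]negbK.
move=> s; have /rowP/(_ s) := vA; rewrite !mxE => <-.
by apply: eq_bigr => r _; rewrite mxE.
Qed.
End WeightedHilbert.
Local Close Scope sesquilinear_scope.

(** * Well-spaced points *)

Section Spacing.
Context {R : realType}.

Lemma sum_inv_sq_dist_le (N r : nat) :
  (r < N)%N -> \sum_(s < N) ((r%:R - s%:R) ^+ 2)^-1 <= pi ^+ 2 / 3 :> R.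
Proof.
move=> rN; rewrite -(big_mkord xpredT (fun s => (r%:R - s%:R : R) ^- 2)).
rewrite (big_cat_nat _ (ltnW rN))//= (big_ltn rN) subrr expr0n/= invr0 add0r.
have -> : \sum_(0 <= s < r) (r%:R - s%:R : R) ^- 2
    = \sum_(0 <= k < r) k.+1%:R ^- 2.
  rewrite big_nat_rev/= !big_nat; apply: eq_bigr => k /= kr.
  by rewrite add0n -natrB ?leq_subr// subKn.
have -> : \sum_(r.+1 <= s < N) (r%:R - s%:R : R) ^- 2
    = \sum_(0 <= k < N - r.+1) k.+1%:R ^- 2.
  rewrite -{1}[r.+1]add0n big_addn; apply: eq_bigr => k _.
  by rewrite -opprB sqrrN addnS -addSn natrD addrK.
by have := sum_inv_sq_le_zeta2 (R := R) r; have := sum_inv_sq_le_zeta2 (R := R) (N - r.+1); lra.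
Qed.

Lemma spaced_dist (N : nat) (lambda : 'I_N -> R) (delta : R) :
  (forall r s : 'I_N, s = r.+1 :> nat -> delta <= lambda s - lambda r) ->
  forall r s : 'I_N, (r <= s)%N -> delta * (s%:R - r%:R) <= lambda s - lambda r.
Proof.
move=> gap r s rs; rewrite -natrB//; move: {2}(s - r)%N (erefl (s - r)%N) => k.
elim: k s rs => [|k IHk] s rs ks.
  have -> : s = r by apply/val_inj/eqP; rewrite eqn_leq rs -subn_eq0 ks.
  by rewrite subnn mulr0 subrr.
have s1 : (s.-1 < N)%N by rewrite (leq_ltn_trans (leq_pred _)).
have sE : s = (Ordinal s1).+1 :> nat.
  by rewrite /= prednK//; move: ks; case: (nat_of_ord s) => //; rewrite sub0n.
have rs1 : (r <= Ordinal s1)%N.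
  by rewrite -ltnS -sE -subn_gt0 ks.
have k1 : (Ordinal s1 - r)%N = k.
  by apply/eqP; rewrite -eqSS -subSn// -sE ks.
have := IHk _ rs1 k1; have := gap _ _ sE.
by rewrite ks k1 -natr1 mulrDr mulr1; lra.
Qed.

Lemma sum_inv_sq_spaced_le (N : nat) (lambda : 'I_N -> R) (delta : R) :
  0 < delta ->
  (forall r s : 'I_N, s = r.+1 :> nat -> delta <= lambda s - lambda r) ->
  forall r, \sum_s ((lambda r - lambda s) ^+ 2)^-1 <= pi ^+ 2 / (3 * delta ^+ 2).
Proof.
move=> d0 gap r.
have -> : pi ^+ 2 / (3 * delta ^+ 2) = delta ^- 2 * (pi ^+ 2 / 3) :> R.
  by rewrite invfM mulrA mulrC.
have := sum_inv_sq_dist_le _ _ (ltn_ord r).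
rewrite -(@ler_pM2l _ (delta ^- 2)) ?invr_gt0 ?exprn_gt0//; apply: le_trans.
rewrite mulr_sumr; apply: ler_sum => s _.
have [->|sr] := eqVneq s r; first by rewrite !subrr expr0n/= invr0 mulr0.
rewrite -invfM -exprMn.
wlog rs : r s sr / (r < s)%N => [hw|].
  have := sr; rewrite -val_eqE/= neq_ltn => /orP[sr'|/hw]; last exact.
  rewrite -(opprB (lambda s)) -(opprB (s%:R)) mulrN !sqrrN.
  by apply: hw => //; rewrite eq_sym.
have srR : 0 < (s%:R - r%:R : R) by rewrite subr_gt0 ltr_nat.
have h := spaced_dist _ _ _ gap _ _ (ltnW rs).
have h0 : 0 < delta * (s%:R - r%:R) by rewrite mulr_gt0.
rewrite -(opprB (lambda s)) -(opprB (s%:R)) mulrN !sqrrN.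
rewrite lef_pV2 ?posrE ?exprn_gt0 ?(lt_le_trans h0)//.
by apply: lerXn2r; rewrite // nnegrE ltW// (lt_le_trans h0).
Qed.

End Spacing.

(** * The kernel of powers *)

Section Powers.
Context {R : realType}.
Implicit Types x y a alpha : R.

Lemma rpow_powR x a : 0 <= x -> rpow x a = x `^ a.
Proof.
move=> x0; rewrite /rpow; case: ifP => // /floorK aE.
by rewrite -{2}aE powR_intmul.
Qed.

Lemma rpow0 x : rpow x 0 = 1.
Proof. by rewrite /rpow rpred0 floor0. Qed.

Lemma rpow1 x : rpow x 1 = x.
Proof. by rewrite /rpow rpred1 floor1. Qed.

(** With [x = exp (m + u)] and [y = exp (m - u)], both sides are
[4 exp (2 alpha m)] times those of [sinh_ratio] at [u] and [p = alpha - 1]. *)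
Lemma powR_kernel_le_pos alpha x y : 1 <= alpha -> 0 < x -> 0 < y ->
  let c z := z `^ ((alpha - 1) / 2) in
  is_true (alpha ^+ 2 * (x - y) ^+ 2 * (c x * c y * (c x * c y + c x ^+ 2 + c y ^+ 2))
    <= 3 * (x `^ alpha - y `^ alpha) ^+ 2).
Proof.
move=> alpha1 x0 y0 c.
wlog xy : x y x0 y0 / y <= x => [hw|].
  have [/hw->//|/ltW/hw] := leP y x.
  rewrite -(opprB x) -(opprB (x `^ _)) !sqrrN => /(_ y0 x0).
  by rewrite (mulrC (c y)) -!addrA (addrC (c y ^+ 2)).
pose u := (ln x - ln y) / 2; pose m := (ln x + ln y) / 2; pose p := alpha - 1.
have u0 : 0 <= u by rewrite divr_ge0// subr_ge0 ler_ln.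
have p0 : 0 <= p by rewrite subr_ge0.
have xE : x = expR (m + u) by rewrite -[LHS]lnK//; congr expR; rewrite /m /u; field.
have yE : y = expR (m - u) by rewrite -[LHS]lnK//; congr expR; rewrite /m /u; field.
pose A := expR (m * (p / 2)); pose h := expR (u * (p / 2)); pose k := expR (- (u * (p / 2))).
have hk : h * k = 1 by rewrite /h /k expRxMexpNx_1.
have cxE : c x = A * h by rewrite /c xE -expRM mulrDl expRD.
have cyE : c y = A * k by rewrite /c yE -expRM mulrBl expRD.
have coshE : h ^+ 2 + k ^+ 2 = 2 * cosh (p * u).
  rewrite /cosh /h /k -!expRM_natr.
  rewrite (_ : u * (p / 2) * 2 = p * u); last by field.
  rewrite (_ : - (u * (p / 2)) * 2 = - (p * u)); last by field.
  by field.
have diffE : x - y = 2 * expR m * sinh u.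
  by rewrite xE yE !expRD /sinh; field.
have diffaE : x `^ alpha - y `^ alpha = 2 * (expR m * A ^+ 2) * sinh ((1 + p) * u).
  have -> : expR m * A ^+ 2 = expR (m * alpha).
    by rewrite /A -expRM_natr -expRD; congr expR; rewrite /p; field.
  have -> : (1 + p) * u = u * alpha by rewrite /p; ring.
  by rewrite xE yE -!expRM mulrDl mulrBl !expRD /sinh; field.
rewrite cxE cyE diffE diffaE.
rewrite (_ : A * h * (A * k) = A ^+ 2); last by rewrite mulrACA hk mulr1.
rewrite (_ : A ^+ 2 * (A ^+ 2 + (A * h) ^+ 2 + (A * k) ^+ 2)
  = A ^+ 4 * (1 + (h ^+ 2 + k ^+ 2))); last by ring.
rewrite coshE.
have := sinh_ratio u p u0 p0.
have q0 : 0 <= 4 * expR m ^+ 2 * A ^+ 4 by rewrite !mulr_ge0 ?exprn_ge0 ?expR_ge0.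
move/(ler_wpM2l q0); rewrite (_ : 1 + p = alpha); last by rewrite /p; ring.
by lra.
Qed.

Lemma rpow_kernel_le alpha x y : 1 <= alpha ->
  alpha = 1 \/ 0 <= x /\ 0 <= y ->
  let c z := rpow z ((alpha - 1) / 2) in
  is_true (c x * c y * (c x * c y + c x ^+ 2 + c y ^+ 2)
      / (rpow x alpha - rpow y alpha) ^+ 2
    <= 3 / alpha ^+ 2 * ((x - y) ^+ 2)^-1).
Proof.
move=> alpha1 hxy c.
have a0 : 0 < alpha by rewrite (lt_le_trans ltr01).
have [->|xy] := eqVneq x y.
  by rewrite !subrr expr0n/= invr0 !mulr0.
have d0 : 0 < (x - y) ^+ 2 by rewrite exprn_even_gt0//= subr_eq0.
have [aE|an1] := eqVneq alpha 1.
  by rewrite /c aE subrr mul0r !rpow0 !rpow1 expr1n divr1 !mulr1 !mul1r; lra.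
have {hxy} [x0 y0] : 0 <= x /\ 0 <= y by case: hxy an1 => // ->; rewrite eqxx.
have nz : (alpha - 1) / 2 != 0 by rewrite mulf_neq0 ?subr_eq0 ?invr_eq0// pnatr_eq0.
rewrite {}/c !rpow_powR//.
have rhs_ge0 : 0 <= 3 / alpha ^+ 2 * (x - y) ^- 2.
  by rewrite mulr_ge0 ?divr_ge0 ?sqr_ge0// invr_ge0 sqr_ge0.
(* A point at 0 has weight 0 once [alpha > 1], so its kernel entries vanish. *)
have [xe|xn] := eqVneq x 0.
  have -> : x `^ ((alpha - 1) / 2) = 0 by rewrite xe powR0.
  by rewrite !mul0r.
have [ye|yn] := eqVneq y 0.
  have -> : y `^ ((alpha - 1) / 2) = 0 by rewrite ye powR0.
  by rewrite mulr0 !mul0r.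
have xp : 0 < x by rewrite lt0r xn.
have yp : 0 < y by rewrite lt0r yn.
have D0 : 0 < (x `^ alpha - y `^ alpha) ^+ 2.
  rewrite exprn_even_gt0//= subr_eq0; apply: contra xy => /eqP.
  by move/(powR_injective a0) => -> //; rewrite nnegrE.
rewrite ler_pdivrMr// -[_ / (x - y) ^+ 2]mulrA -invfM [leRHS]mulrAC ler_pdivlMr; last by rewrite mulr_gt0// exprn_gt0.
by have /= := powR_kernel_le_pos alpha x y alpha1 xp yp; lra.
Qed.

Lemma rpow_inj alpha x y : 1 <= alpha -> alpha = 1 \/ 0 <= x /\ 0 <= y ->
  rpow x alpha = rpow y alpha -> x = y.
Proof.
move=> alpha1 [->|[x0 y0]]; first by rewrite !rpow1.
rewrite !rpow_powR// => /powR_injective; apply; rewrite ?nnegrE//.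
exact: lt_le_trans alpha1.
Qed.

Lemma rpow_ge0 alpha x : alpha = 1 \/ 0 <= x -> 0 <= rpow x ((alpha - 1) / 2).
Proof.
by move=> [->|x0]; [rewrite subrr mul0r rpow0|rewrite rpow_powR ?powR_ge0].
Qed.

Lemma rpowM alpha x y : alpha = 1 \/ 0 <= x /\ 0 <= y ->
  rpow (x * y) ((alpha - 1) / 2)
    = rpow x ((alpha - 1) / 2) * rpow y ((alpha - 1) / 2).
Proof.
move=> [->|[x0 y0]]; first by rewrite subrr mul0r !rpow0 mulr1.
by rewrite !rpow_powR ?mulr_ge0 ?powRM.
Qed.

End Powers.

(** * The inequality *)

Local Open Scope complex_scope.

Theorem theorem1p3 (R : realType) (alpha : R) (N : nat) (lambda : 'I_N -> R)
    (delta : R) (w : 'I_N -> R[i]) :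
  1 <= alpha ->
  (alpha = 1 \/ forall r : 'I_N, 0 <= lambda r) ->
  (forall r s : 'I_N, (r < s)%N -> lambda r < lambda s) ->
  0 < delta ->
  (forall r s : 'I_N, s = r.+1 :> nat -> delta <= lambda s - lambda r) ->
  `| \sum_(r < N) \sum_(s < N | s != r)
       (rpow (lambda r * lambda s) ((alpha - 1) / 2))%:C * w r * (w s)^*
         / (rpow (lambda r) alpha - rpow (lambda s) alpha)%:C |
  <= (pi / (alpha * delta))%:C * \sum_(r < N) `|w r| ^+ 2.
Proof.
move=> alpha1 lambda_ge0 lambda_incr delta0 gap.
have pos2 r s : alpha = 1 \/ 0 <= lambda r /\ 0 <= lambda s.
  by case: lambda_ge0 => [|h]; [left|right; split].
have pos1 r : alpha = 1 \/ 0 <= lambda r.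
  by case: lambda_ge0 => [|h]; [left|right].
have a0 : 0 < alpha by rewrite (lt_le_trans ltr01).
pose c r : R := rpow (lambda r) ((alpha - 1) / 2).
pose mu r : R := rpow (lambda r) alpha.
pose K : R := pi / (alpha * delta).
have lambda_inj : injective lambda.
  move=> r s rs; apply: ord_inj.
  by have [/lambda_incr|/lambda_incr|//] := ltngtP r s; rewrite rs ltxx.
have muC_inj : injective (fun r => (mu r)%:C).
  by move=> r s /complexI/(rpow_inj _ _ _ alpha1 (pos2 r s)) /lambda_inj.
have K0 : 0 <= K by rewrite divr_ge0 ?pi_ge0// mulr_ge0 ?ltW.
have rowR r : \sum_s c r * c s * (c r * c s + c r ^+ 2 + c s ^+ 2)
    / (mu r - mu s) ^+ 2 <= K ^+ 2.
  apply: (@le_trans _ _ (3 / alpha ^+ 2 * (pi ^+ 2 / (3 * delta ^+ 2)))).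
    apply: le_trans (ler_wpM2l _ (sum_inv_sq_spaced_le _ _ _ delta0 gap r)).
      by rewrite mulr_sumr; apply: ler_sum => s _; exact: rpow_kernel_le.
    by rewrite divr_ge0 ?exprn_ge0 ?ltW.
  rewrite /K; move: pi => q; rewrite le_eqVlt; apply/orP; left; apply/eqP.
  by field; rewrite !gt_eqF.
have := @weighted_hilbert_inequality _ _ (fun r => (c r)%:C) (fun r => (mu r)%:C)
  _ _ muC_inj K%:C w _ _.
have -> : \sum_(r < N) \sum_(s < N) (c r)%:C * (c s)%:C / ((mu r)%:C - (mu s)%:C)
      * w r * (w s)^*
  = \sum_(r < N) \sum_(s < N | s != r)
       (rpow (lambda r * lambda s) ((alpha - 1) / 2))%:C * w r * (w s)^*
         / (rpow (lambda r) alpha - rpow (lambda s) alpha)%:C.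
  apply: eq_bigr => r _; rewrite (bigD1 r)//= subrr invr0 !(mulr0, mul0r) add0r.
  apply: eq_bigr => s _; rewrite rpowM// rmorphM rmorphB/= -/(c r) -/(c s).
  by rewrite -!mulrA; congr (_ * (_ * _)); rewrite mulrC mulrA.
apply.
- by move=> r; rewrite ler0c rpow_ge0.
- by move=> r; apply/complex_realP; exists (mu r).
- by rewrite ler0c.
move=> r; have -> : K%:C ^+ 2 = (K ^+ 2)%:C by rewrite rmorphXn.
apply: le_trans (_ : (\sum_s c r * c s * (c r * c s + c r ^+ 2 + c s ^+ 2)
    / (mu r - mu s) ^+ 2)%:C <= _); last by rewrite lecR.
rewrite rmorph_sum le_eqVlt; apply/orP; left; apply/eqP; apply: eq_bigr => s _.
by rewrite !(rmorphXn, fmorphV, rmorphB, rmorphM, rmorphD).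
Qed.
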